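(* Let $X^m$ be an orthant space. For any two points $x^*$ and $x$ in $X^m$, let the sequences $\mathcal{A}=(A_0,\dots,A_k)$ and $\mathcal{B}=(B_0,\dots,B_k)$ of sets of axes form the support of the geodesic from $x^*$ to $x$. Then the translated logarithm map $\Phi(\,\cdot\,;x^* )$ at $x^*$ is given by $$\Phi(x;x^* )=\jmath\left(P_{B_0}(x),\,-\frac{\|P_{B_1}(x)\|}{\|P_{A_1}(x^* )\|}P_{A_1}(x^* ),\,\dots,\,-\frac{\|P_{B_k}(x)\|}{\|P_{A_k}(x^* )\|}P_{A_k}(x^* )\right).$$
   Context: Orthant spaces. Let $U=(u_1,\dots,u_M)$ be the standard orthonormal basis of $\mathbb{R}^M$; its elements are called axes. For $E\subseteq U$, $\mathbb{R}(E)$ is the span of $E$ and $\mathcal{O}(E)=\{\sum_{e\in E}\lambda_e e:\lambda_e>0\}$ is an open positive orthant ($\mathcal{O}(\emptyset)=\{o\}$, $o$ the origin). An orthant space $X^m$ of dimension $m\le M$ is a subspace of $\mathbb{R}^M$ that is a union of open positive orthants (its strata) of maximum dimension $m$, with the intrinsic (length) metric $d$ induced from the Euclidean metric, such that (i) for every orthant $\sigma$ in $X^m$ the orthants in its closure are also in $X^m$; (ii) if all the 2-dimensional orthants in the closure of a positive orthant $\sigma$ of $\mathbb{R}^M$ are in $X^m$ then $\sigma$ is in $X^m$. $X^m$ is a CAT(0)-space, so any two points are joined by a unique geodesic, which is linear within each stratum. Carriers and supports. $E(x)$ is the set of axes along which $x\in X^m$ has positive coordinates. Sets $E,F\subseteq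 U$ are compatible if $\mathcal{O}(E\cup F)\subseteq X^m$. The carrier of the geodesic from $x_1$ to $x_2$ is the sequence $(\mathcal{O}_0,\dots,\mathcal{O}_k)$ of strata, in the order traversed, whose intersection with the geodesic is a line segment of positive length. Put $E(x_1,x_2)=(E(x_1)\cap E(x_2))\cup\{e\in E(x_1): e\text{ compatible with }E(x_2)\}\cup\{e\in E(x_2): e\text{ compatible with }E(x_1)\}$. The support of the geodesic is the pair $(\mathcal{A},\mathcal{B})$ of sequences $\mathcal{A}=(A_0,\dots,A_k)$, $\mathcal{B}=(B_0,\dots,B_k)$ with $A_0=B_0=E(x_1,x_2)$ and, for $i\ge1$, $A_i$ (resp. $B_i$) the set of all axes whose coordinates become zero (resp. positive) as the geodesic passes from $\mathcal{O}_{i-1}$ to $\mathcal{O}_i$; thus $\mathcal{O}_i=\mathcal{O}(A_0\cup B_1\cup\cdots\cup B_i\cup A_{i+1}\cup\cdots\cup A_k)$. If $x_1,x_2$ lie in the closure of a common orthant then $k=0$. Projections. $P_E(x)$ is the Euclidean orthogonal projection of $x$ onto $\mathbb{R}(E)$ (the vector of components of $x$ along the axes in $E$). $\jmath$ is the linear map positioning a list of coordinates indexed by a set of axes as the corresponding coordinates, with respect to $U$, of a vector of $\mathbb{R}^M$ (all other coordinates zero). In the displayed formula the coordinates are those along $A_0,A_1,\dots,A_k$ in turn. Logarithm map. For $x^*\in\sigma=\mathcal{O}(E)$ the tangent cone to $X^m$ at $x^*$ is the union of the sets $\mathbb{R}(E)\times\overline{\mathcal{O}(F)}$ over $F$ disjoint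 from $E$ with $\mathcal{O}(E\cup F)\subseteq X^m$, glued along common faces and regarded in $\mathbb{R}^M$; translated to the origin it is denoted $C_\sigma$. $\log_{x^*}(x)$ is the initial (one-sided) tangent vector, of norm $d(x^*,x)$, of the geodesic from $x^*$ to $x$. The translated logarithm map is $\Phi(x;x^* )=\log_{x^*}(x)+x^*\in C_\sigma$. *)

(* Defs.v *)
From HB Require Import structures.
From mathcomp Require Import all_boot all_order all_algebra.
From mathcomp Require Import all_classical all_reals all_analysis.

Set Implicit Arguments.
Unset Strict Implicit.
Unset Printing Implicit Defensive.

Import Order.TTheory GRing.Theory Num.Theory.
Import numFieldNormedType.Exports.

Local Open Scope classical_set_scope.
Local Open Scope ring_scope.

(* R^M is 'rV[R]_M and the axes are the indices in 'I_M, so a set of axes is a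
   {set 'I_M}.  The library norm on 'rV[R]_M is the sup norm; it induces the
   usual topology and is used for continuity and limits only.  All lengths are
   measured with the Euclidean norm enorm. *)

Section OrthantSpace.
Variables (R : realType) (M : nat).
Implicit Types (X : set 'rV[R]_M) (E F : {set 'I_M}) (x y v w : 'rV[R]_M).
Implicit Types (g : R -> 'rV[R]_M).

Definition enorm v : R := Num.sqrt (\sum_(e < M) v 0 e ^+ 2).

Definition orthant E : set 'rV[R]_M :=
  [set v | (forall e, e \in E -> 0 < v 0 e) /\
           (forall e, e \notin E -> v 0 e = 0)].

Definition orthant_space (m : nat) X : Prop :=
  [/\ exists K : {set {set 'I_M}}, X = \bigcup_(E in [set` K]) orthant E,
      (exists2 E, orthant E `<=` X & #|E| = m)
        /\ (forall E, orthant E `<=` X -> (#|E| <= m)%N),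
      forall E F, orthant E `<=` X -> orthant F `<=` closure (orthant E) ->
        orthant F `<=` X
    & forall E,
        (forall F, #|F| = 2%N -> orthant F `<=` closure (orthant E) ->
           orthant F `<=` X) ->
        orthant E `<=` X].

Definition is_path X x y g : Prop :=
  [/\ {within `[0, 1], continuous g}, g 0 = x, g 1 = y
    & forall t : R, t \in `[0, 1] -> X (g t)].

(* Length of g on [0, 1]: supremum of the lengths of the inscribed polygonal
   lines.  A subdivision s does not list its first point 0. *)
Definition path_length g : \bar R :=
  ereal_sup [set (\sum_(i < size s)
                    enorm (g (nth 0 (0 :: s) i.+1) - g (nth 0 (0 :: s) i)))%:E
            | s in itv_partition 0 1].

Definition dist X x y : \bar R := ereal_inf (path_length @` is_path X x y).

(* Geodesics are parametrized on [0, 1] proportionally to arc length. *)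
Definition is_geodesic X x y g : Prop :=
  is_path X x y g /\
  forall s t : R, s \in `[0, 1] -> t \in `[0, 1] ->
    dist X (g s) (g t) = (`|s - t|%:E * dist X x y)%E.

Definition axes x : {set 'I_M} := [set e | 0 < x 0 e]%SET.

Definition compatible X E F : Prop := orthant (E :|: F)%SET `<=` X.

Definition common_axes X x1 x2 : {set 'I_M} :=
  ((axes x1 :&: axes x2)
   :|: [set e in axes x1 | `[< compatible X [set e] (axes x2) >]]
   :|: [set e in axes x2 | `[< compatible X [set e] (axes x1) >]])%SET.

(* The stratum orthant O_i is represented by O_i.  Each stratum of the carrier
   is crossed during a nondegenerate open time interval; for a nonconstant
   geodesic this means that it meets the geodesic in a segment of positive
   length.  A constant geodesic has the carrier consisting of the stratum of
   its point (k = 0). *)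
Definition is_carrier (k : nat) g (O : k.+1.-tuple {set 'I_M}) : Prop :=
  exists t : nat -> R,
    [/\ t 0%N = 0, t k.+1 = 1,
        forall i, (i <= k)%N -> t i < t i.+1,
        forall i, (i <= k)%N -> forall s : R, s \in `]t i, t i.+1[ ->
          orthant (nth finset.set0 O i) (g s)
      & forall i, (i < k)%N -> nth finset.set0 O i <> nth finset.set0 O i.+1].

Definition is_support X (k : nat) x1 x2 g (A B : k.+1.-tuple {set 'I_M}) :
    Prop :=
  exists O : k.+1.-tuple {set 'I_M},
    [/\ is_carrier g O,
        nth finset.set0 A 0 = common_axes X x1 x2,
        nth finset.set0 B 0 = common_axes X x1 x2
      & forall i, (i < k)%N ->
          nth finset.set0 A i.+1
            = (nth finset.set0 O i :\: nth finset.set0 O i.+1)%SET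
          /\ nth finset.set0 B i.+1
            = (nth finset.set0 O i.+1 :\: nth finset.set0 O i)%SET].

Definition axes_proj E x : 'rV[R]_M := \row_e (if e \in E then x 0 e else 0).

(* Only the coordinates of v i along A_i are used; this is the usual list of
   coordinates when the A_i are pairwise disjoint. *)
Definition jmath (k : nat) (A : k.+1.-tuple {set 'I_M})
    (v : 'I_k.+1 -> 'rV[R]_M) : 'rV[R]_M :=
  \row_e \sum_(i < k.+1 | e \in tnth A i) v i 0 e.

(* The tangent cone at xs, with its apex translated to the origin: the union of
   the sets R(E) x closure(O(F)), E being the set of axes of xs. *)
Definition tangent_cone X xs : set 'rV[R]_M :=
  [set v | exists F : {set 'I_M},
     [/\ [disjoint F & axes xs]%B, orthant (axes xs :|: F)%SET `<=` X,
         forall e, e \in F -> 0 <= v 0 e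
       & forall e, e \notin (axes xs :|: F)%SET -> v 0 e = 0]].

(* The logarithm of x at xs, read off a geodesic g from xs to x. *)
Definition is_log X xs x g v : Prop :=
  [/\ t^-1 *: (g t - g 0) @[t --> 0^'+] --> v,
      (enorm v)%:E = dist X xs x
    & tangent_cone X xs v].

Definition is_translated_log X xs x g w : Prop :=
  exists v, [/\ is_log X xs x g v, w = v + xs & tangent_cone X xs w].

End OrthantSpace.

(* Main.v *)
Require Import Defs.
From HB Require Import structures.
From mathcomp Require Import all_boot all_order all_algebra.
From mathcomp Require Import all_classical all_reals all_analysis.
From mathcomp Require Import ring lra zify.

Set Implicit Arguments.
Unset Strict Implicit.
Unset Printing Implicit Defensive.

Import Order.TTheory GRing.Theory Num.Theory.
Import numFieldNormedType.Exports.

Local Open Scope classical_set_scope.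
Local Open Scope ring_scope.

(** Write [g] for the geodesic from [xs] to [x], [D] for its length and [O i]
for its strata, crossed during the time intervals from [t i] to [t i.+1].

Everything rests on one principle, [straighten]: if adjoining an axis [e] to
each point of a stretch of [g] stays inside [X], then the [e]-coordinate of [g]
is an affine function of time along that stretch.  Indeed, replacing that
coordinate by its linear interpolation gives another path in [X] with the same
end points; if the coordinate was not affine, the new path has strictly smaller
energy, hence is strictly shorter, which a geodesic forbids.  Length is bounded
above by a calibration: a function [Phi] of time whose increments dominate all
chords of the path also dominates the length of the path.

Three consequences follow.
- Inside one stratum, and across consecutive strata that share an axis, the
  coordinate is affine.  So a coordinate cannot vanish, become positive and
  vanish again ([no_temporary_axis]).
- A coordinate cannot be positive, vanish and become positive again
  ([no_returning_axis]): every other axis present meanwhile is present before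
  or after, hence is compatible with the returning one, and by the flag
  condition the returning axis can be adjoined all along, so that its
  coordinate is affine.  The same reasoning shows that the axes of
  [common_axes X xs x] are exactly those present throughout ([mem_common_axes]).
- Thus each coordinate follows one of four scenarios: always zero; affine on
  the whole interval; affine and positive until it vanishes for good at [t j];
  zero until [t j], then affine and positive.

On each time interval [g] is linear with speed [D].  At [t j] the velocity
changes only along the axes of [A j], which disappear, and [B j], which appear,
so the two corresponding partial velocities have the same norm:
|P_(A j) xs| / t j = |P_(B j) x| / (1 - t j) ([balance]).  The initial velocity
along an axis [e] of [A j] is - xs_e / t j; adding xs_e and eliminating [t j]
with the balance equation gives the coefficient of the formula, while an axis
present throughout contributes xs_e + (x_e - xs_e) = x_e. *)

(** * The Euclidean norm *)

Section Euclidean.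
Variables (R : realType) (M : nat).
Implicit Types (v w : 'rV[R]_M).

Lemma enorm_ge0 v : 0 <= enorm v.
Proof. exact: sqrtr_ge0. Qed.

Lemma enorm_sq v : enorm v ^+ 2 = \sum_e v 0 e ^+ 2.
Proof. by rewrite sqr_sqrtr// sumr_ge0// => e _; exact: sqr_ge0. Qed.

Lemma coord_le_enorm v e : `|v 0 e| <= enorm v.
Proof.
rewrite -(@ler_pXn2r _ 2)// ?nnegrE ?enorm_ge0// enorm_sq real_normK ?num_real//.
by rewrite (bigD1 e)//= lerDl sumr_ge0// => i _; exact: sqr_ge0.
Qed.

Lemma enorm_gt0 v e : v 0 e != 0 -> 0 < enorm v.
Proof. by move=> ve; apply: lt_le_trans (coord_le_enorm v e); rewrite normr_gt0. Qed.

Lemma enormZ (a : R) v : enorm (a *: v) = `|a| * enorm v.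
Proof.
apply/eqP; rewrite -(@eqrXn2 _ 2)// ?mulr_ge0 ?enorm_ge0// exprMn !enorm_sq.
rewrite real_normK ?num_real// mulr_sumr; apply/eqP/eq_bigr => e _.
by rewrite mxE exprMn.
Qed.

Lemma enormN v : enorm (- v) = enorm v.
Proof. by rewrite -scaleN1r enormZ normrN1 mul1r. Qed.

Lemma coord_eq0_of_enorm v e : enorm v = 0 -> v 0 e = 0.
Proof.
by move=> v0; apply/eqP; rewrite -normr_eq0 eq_le normr_ge0 andbT -v0 coord_le_enorm.
Qed.

(** Expand the sum of squares of the coordinates of |w| v - |v| w. *)
Lemma cauchy_schwarz v w : \sum_e v 0 e * w 0 e <= enorm v * enorm w.
Proof.
have [v0|v0] := eqVneq (enorm v) 0.
  by rewrite big1 ?mulr_ge0 ?enorm_ge0// => e _; rewrite coord_eq0_of_enorm ?mul0r.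
have [w0|w0] := eqVneq (enorm w) 0.
  rewrite big1 ?mulr_ge0 ?enorm_ge0// => e _.
  by rewrite [w 0 e]coord_eq0_of_enorm ?mulr0.
have vw0 : 0 < enorm v * enorm w by rewrite mulr_gt0// lt_neqAle eq_sym ?v0 ?w0 enorm_ge0.
rewrite -(ler_pM2l vw0).
have : 0 <= \sum_e (enorm w * v 0 e - enorm v * w 0 e) ^+ 2.
  by rewrite sumr_ge0// => e _; exact: sqr_ge0.
rewrite (eq_bigr (fun e => enorm w ^+ 2 * v 0 e ^+ 2 + enorm v ^+ 2 * w 0 e ^+ 2
  - 2 * (enorm v * enorm w) * (v 0 e * w 0 e))); last by move=> e _; ring.
rewrite big_split/= sumrN big_split/= -!mulr_sumr -!enorm_sq.
set S := \sum_e _; lra.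
Qed.

Lemma enormD v w : enorm (v + w) <= enorm v + enorm w.
Proof.
rewrite -(@ler_pXn2r _ 2)// ?nnegrE ?addr_ge0 ?enorm_ge0// enorm_sq sqrrD !enorm_sq.
rewrite (eq_bigr (fun e => v 0 e ^+ 2 + 2 * (v 0 e * w 0 e) + w 0 e ^+ 2)); last first.
  by move=> e _; rewrite mxE; ring.
rewrite !big_split/= -mulr_sumr lerD2r lerD2l -[leRHS]mulr_natl ler_pM2l//.
exact: cauchy_schwarz.
Qed.

Lemma norm_le_enorm v : `|v| <= enorm v.
Proof.
rewrite [leLHS]/Num.Def.normr/= mx_normrE; apply: bigmax_le => [|[i j] _ /=].
  exact: enorm_ge0.
by rewrite ord1; exact: coord_le_enorm.
Qed.

(** The sup norm is at most the Euclidean norm, so a Euclidean Lipschitz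
bound gives continuity for the topology of the row vectors. *)
Lemma lipschitz_continuous (C : R) (h : R -> 'rV[R]_M) :
  (forall a b, 0 <= a -> a <= b -> b <= 1 -> enorm (h b - h a) <= C * (b - a)) ->
  {within `[0, 1], continuous h}.
Proof.
move=> hC; apply/subspace_continuousP => a; rewrite /= in_itv/= => /andP[a0 a1].
apply/cvgrPdist_le => eps eps0; rewrite near_withinE.
have C1 : 0 < `|C| + 1 by rewrite ltr_pwDr.
near=> b.
rewrite /= in_itv/= => /andP[b0 b1].
have ab : `|a - b| <= eps / (`|C| + 1).
  by near: b; apply: cvgr_dist_le; [exact: cvg_id|rewrite divr_gt0].
have hh : enorm (h a - h b) <= (`|C| + 1) * `|a - b|.
  have [ba|/ltW ba] := leP b a.
    rewrite (le_trans (hC _ _ _ _ _))// [`|a - b|]ger0_norm ?subr_ge0//.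
    by rewrite ler_wpM2r ?subr_ge0// (le_trans (ler_norm _))// lerDl.
  rewrite -enormN opprB (le_trans (hC _ _ _ _ _))// distrC.
  rewrite [`|b - a|]ger0_norm ?subr_ge0//.
  by rewrite ler_wpM2r ?subr_ge0// (le_trans (ler_norm _))// lerDl.
apply: le_trans (norm_le_enorm _) (le_trans hh _).
by rewrite mulrC -ler_pdivlMr.
Unshelve. all: by end_near.
Qed.

End Euclidean.

(** * Length and distance *)

Section Distance.
Variables (R : realType) (M : nat).
Implicit Types (X : set 'rV[R]_M) (x y : 'rV[R]_M) (h : R -> 'rV[R]_M).

(** The increments of [Phi] telescope along a subdivision. *)
Lemma calibrated_length (Phi : R -> R) h :
  (forall a b, 0 <= a -> a <= b -> b <= 1 -> enorm (h b - h a) <= Phi b - Phi a) ->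
  (path_length h <= (Phi 1 - Phi 0)%R%:E)%E.
Proof.
move=> hPhi; apply: ge_ereal_sup => _ [s s01 <-]; rewrite lee_fin.
suff gen a : 0 <= a -> path <%R a s -> last a s <= 1 ->
    \sum_(i < size s) enorm (h (nth 0 (a :: s) i.+1) - h (nth 0 (a :: s) i))
    <= Phi (last a s) - Phi a.
  have [ps /eqP ls] := s01.
  by move: (gen 0 (lexx _) ps); rewrite ls => /(_ (lexx _)).
elim: s a {s01} => [a|b s IH a] a0 /=; first by rewrite big_ord0 subrr.
move=> /andP[ab pbs] l1; rewrite big_ord_recl/=.
have bl : b <= last b s.
  case: s pbs {IH l1} => // c s pbs.
  exact: ltW (allP (order_path_min lt_trans pbs) _ (mem_last _ _)).
have b1 : b <= 1 by exact: le_trans bl l1.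
have b0 : 0 <= b by rewrite (le_trans a0)// ltW.
have := IH _ b0 pbs l1; have := hPhi a b a0 (ltW ab) b1.
lra.
Qed.

Lemma enorm_le_dist X x y : ((enorm (y - x))%:E <= dist X x y)%E.
Proof.
apply: le_ereal_inf_tmp => _ [h [_ h0 h1 _] <-].
apply: ereal_sup_ubound; exists [:: 1].
  by split; rewrite /= ?ltr01 ?andbT.
by rewrite big_ord_recl big_ord0 addr0/= h0 h1.
Qed.

(** The Lipschitz bound serves only to make [h] continuous; the estimate of
the distance comes from the calibration [Phi]. *)
Lemma dist_le X h (C : R) (Phi : R -> R) :
  (forall a, 0 <= a -> a <= 1 -> X (h a)) ->
  (forall a b, 0 <= a -> a <= b -> b <= 1 -> enorm (h b - h a) <= C * (b - a)) ->
  (forall a b, 0 <= a -> a <= b -> b <= 1 -> enorm (h b - h a) <= Phi b - Phi a) ->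
  (dist X (h 0%R) (h 1%R) <= (Phi 1 - Phi 0)%R%:E)%E.
Proof.
move=> Xh hC hPhi; apply: le_trans (calibrated_length hPhi).
apply: ereal_inf_lbound; exists h => //; split => //.
  exact: lipschitz_continuous hC.
by move=> t; rewrite in_itv/= => /andP[t0 t1]; exact: Xh.
Qed.

End Distance.

(** * Strata of an orthant space *)

Section Strata.
Variables (R : realType) (M m : nat) (X : set 'rV[R]_M).
Hypothesis hX : orthant_space m X.
Implicit Types (E F : {set 'I_M}) (p : 'rV[R]_M).

Lemma orthant_axes E p : orthant E p -> axes p = E.
Proof.
move=> [pE p0]; apply/setP => e; rewrite inE.
by have [/pE->//|/p0->] := boolP (e \in E); rewrite ltxx.
Qed.

Lemma axes_orthant p : (forall e, 0 <= p 0 e) -> orthant (axes p) p.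
Proof.
move=> p0; split=> e; rewrite inE // => pe.
by apply/eqP; rewrite eq_le p0 andbT leNgt.
Qed.

Lemma point_orthant p : X p -> exists2 E, orthant E `<=` X & orthant E p.
Proof.
case: hX => -[K XK] _ _ _; rewrite XK => -[E KE pE]; exists E => //.
by move=> q qE; exists E.
Qed.

Lemma coord_ge0 p e : X p -> 0 <= p 0 e.
Proof.
move=> /point_orthant[E _ [pE p0]].
by have [/pE/ltW//|/p0->//] := boolP (e \in E).
Qed.

Lemma meets_stratum E p : orthant E p -> X p -> orthant E `<=` X.
Proof.
by move=> pE /point_orthant[F FX pF]; rewrite -(orthant_axes pE) (orthant_axes pF).
Qed.

(** Adding a small positive amount along the missing axes moves a point of
the face into the open orthant. *)
Lemma face_closure E F : F \subset E -> orthant F `<=` closure (orthant E : set 'rV[R]_M).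
Proof.
move=> FE v [vF v0] B /nbhs_ballP[/= eps eps0 Bv].
pose w : 'rV[R]_M := \row_e (if e \in E :\: F then eps / 2 else 0).
exists (v + w); split.
  split=> e eE; rewrite !mxE inE.
    by have [/vF|/v0->/=] := boolP (e \in F); rewrite /= ?eE ?addr0// add0r divr_gt0.
  by rewrite (negbTE eE) andbF addr0 v0//; apply: contraNN eE => /(fintype.subsetP FE).
apply: Bv; rewrite -ball_normE/= opprD addrA subrr sub0r normrN.
rewrite [ltLHS]/Num.Def.normr/= mx_normrE; apply: bigmax_lt => //= -[i j] _ /=.
rewrite mxE; case: ifPn => _; rewrite ?normr0// ger0_norm ?divr_ge0 ?ltW//.
by rewrite ltr_pdivrMr// ltr_pMr// ltr1n.
Qed.

(** Coordinates outside [E] vanish on the closure of the orthant of [E],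
whereas the point of the orthant of [F] with unit coordinates keeps distance
at least 1 from it if [F] has an axis outside [E]. *)
Lemma closure_face E F : orthant F `<=` closure (orthant E : set 'rV[R]_M) -> F \subset E.
Proof.
move=> FE; apply/fintype.subsetP => e eF; apply/negPn/negP => eE.
pose w : 'rV[R]_M := \row_e (if e \in F then 1 else 0).
have wF : orthant F w.
  by split=> i iF; rewrite mxE ?iF// (negbTE iF).
have [|v [[_ /(_ e eE) ve0]]] := FE w wF (ball w 1); first exact: nbhsx_ballx.
rewrite -ball_normE/= => /(le_lt_trans _)-/(_ 1).
rewrite ltxx => /(_ _)/notF; apply.
rewrite [leRHS]/Num.Def.normr/= mx_normrE.
by apply/bigmax_geP; right => /=; exists (0, e) => //=; rewrite !mxE eF ve0 subr0 normr1.
Qed.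

Lemma stratum_sub E F : F \subset E -> orthant E `<=` X -> orthant F `<=` X.
Proof. by case: hX => _ _ h _ FE EX; apply: h EX (face_closure FE). Qed.

(** By [closure_face], the two-dimensional orthants in the closure of the orthant
of [E] are those of the pairs of axes of [E]. *)
Lemma stratum_flag E :
  (forall e f, e \in E -> f \in E -> e != f -> orthant [set e; f]%SET `<=` X) ->
  orthant E `<=` X.
Proof.
case: hX => _ _ _ h EX; apply: h => F /eqP/cards2P[e [f [ef ->]]] /closure_face.
by rewrite finset.subUset !finset.sub1set => /andP[eE fE]; exact: EX.
Qed.

Lemma stratum_point E p : orthant E `<=` X -> (forall e, 0 <= p 0 e) ->
  axes p \subset E -> X p.
Proof. by move=> EX p0 pE; exact: (stratum_sub pE EX) (axes_orthant p0). Qed.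

Lemma stratum_setU1 e E : orthant E `<=` X ->
  (forall f, f \in E -> orthant (e |: [set f])%SET `<=` X) -> orthant (e |: E)%SET `<=` X.
Proof.
move=> EX eX; apply: stratum_flag => a b; rewrite !inE.
case/predU1P=> [->|aE] /predU1P[->|bE] ab.
- by rewrite eqxx in ab.
- exact: eX.
- by rewrite finset.setUC; exact: eX.
- by apply: stratum_sub EX; rewrite finset.subUset !finset.sub1set aE.
Qed.

(** An orthant space is starlike about the origin, so any two points are joined
by a path of finite length through the origin. *)
Lemma dist_fin x y : X x -> X y -> exists2 D : R, 0 <= D & dist X x y = D%:E.
Proof.
move=> Xx Xy.
have scale p a : X p -> 0 <= a -> X (a *: p).
  move=> Xp a0; have [E EX pE] := point_orthant Xp.
  apply: (stratum_point EX) => [e|].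
    by rewrite mxE mulr_ge0// coord_ge0.
  rewrite -(orthant_axes pE); apply/fintype.subsetP => e; rewrite !inE mxE => ap.
  by rewrite lt_neqAle coord_ge0// andbT; apply: contraTneq ap => <-; rewrite mulr0 ltxx.
(* The path [h] runs straight from [x] to the origin, then straight to [y]. *)
pose u (t : R) := Num.max 0 (1 - 2 * t); pose v (t : R) := Num.max 0 (2 * t - 1).
pose h t := u t *: x + v t *: y.
pose C := 2 * (enorm x + enorm y).
have hX' a : 0 <= a -> a <= 1 -> X (h a).
  move=> _ _; rewrite /h; have [a1|a1] := leP (2 * a) 1.
    rewrite /v max_l ?subr_le0// scale0r addr0.
    by apply: scale => //; rewrite le_max lexx.
  rewrite /u max_l ?subr_le0 1?ltW// scale0r add0r.
  by apply: scale => //; rewrite le_max lexx.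
have hC a b : 0 <= a -> a <= b -> b <= 1 -> enorm (h b - h a) <= C * (b - a).
  move=> a0 ab b1.
  have -> : h b - h a = (u b - u a) *: x + (v b - v a) *: y.
    by rewrite /h !scalerBl opprD addrACA.
  have uab : `|u b - u a| <= 2 * (b - a).
    rewrite ler_norml /u /Num.max; do 2 case: ifPn; rewrite -?leNgt => *; lra.
  have vab : `|v b - v a| <= 2 * (b - a).
    rewrite ler_norml /v /Num.max; do 2 case: ifPn; rewrite -?leNgt => *; lra.
  apply: le_trans (enormD _ _) _; rewrite !enormZ /C mulrAC mulrDr.
  by apply: lerD; rewrite ler_wpM2r ?enorm_ge0.
have : (dist X x y <= (C * 1 - C * 0)%:E)%E.
  have <- : h 0 = x.
    by rewrite /h /u /v mulr0 subr0 sub0r max_r// max_l// scale1r scale0r addr0.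
  have <- : h 1 = y.
    by rewrite /h /u /v mulr1 max_l ?max_r ?scale0r ?add0r; [rewrite addrK scale1r|lra|lra].
  by apply: (dist_le hX' hC (Phi := fun t => C * t)) => a b *; rewrite -mulrBr hC.
move: (enorm_le_dist X x y) (enorm_ge0 (y - x)).
case: (dist X x y) => [D|//|//]; rewrite !lee_fin => D0 e0 _.
by exists D => //; exact: le_trans e0 D0.
Qed.
End Strata.

(** * The straightening principle *)

(** A chord of the straightened path has length [n], where [N] is the
length of the original chord, [del] its component along the straightened axis,
and [L] the slope that replaces this component.  The bound combines
2 K d n <= n^2 + (K d)^2 with (del - mu d)^2 >= 0; it is additive in time,
because [d] and [del] are increments. *)
Lemma calibration_step (R : realType) (K L mu d del n N : R) :
  0 < K -> 0 <= d -> n ^+ 2 = N ^+ 2 - del ^+ 2 + L ^+ 2 * d ^+ 2 ->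
  N ^+ 2 <= K ^+ 2 * d ^+ 2 ->
  n <= K * d + (L ^+ 2 * d - 2 * mu * del + mu ^+ 2 * d) / (2 * K).
Proof.
move=> K0 d_ge0 nN NK; have := d_ge0; rewrite le_eqVlt => /predU1P[d0|d0].
  have N0 : 0 <= N ^+ 2 by exact: sqr_ge0.
  have del0 : del ^+ 2 <= 0.
    have := sqr_ge0 n; rewrite -d0 expr0n /= !mulr0 in nN NK; lra.
  have n20 : n ^+ 2 <= 0.
    have := sqr_ge0 del; rewrite -d0 expr0n /= !mulr0 in nN NK; lra.
  have {}del0 : del = 0 by apply/eqP; rewrite -sqrf_eq0 eq_le del0 sqr_ge0.
  have -> : n = 0 by apply/eqP; rewrite -sqrf_eq0 eq_le n20 sqr_ge0.
  by rewrite del0 -d0 !mulr0 subr0 addr0 mul0r addr0.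
have Kd0 : 0 < 2 * K * d by rewrite !mulr_gt0.
rewrite -(ler_pM2l Kd0).
have -> : 2 * K * d * (K * d + (L ^+ 2 * d - 2 * mu * del + mu ^+ 2 * d) / (2 * K)) =
   2 * K ^+ 2 * d ^+ 2 + L ^+ 2 * d ^+ 2 - 2 * mu * del * d + mu ^+ 2 * d ^+ 2.
  by field; rewrite gt_eqF.
by have := sqr_ge0 (n - K * d); have := sqr_ge0 (del - mu * d); lra.
Qed.

Section Straightening.
Variables (R : realType) (M m : nat) (X : set 'rV[R]_M).
Hypothesis hX : orthant_space m X.
Implicit Types (g : R -> 'rV[R]_M) (e : 'I_M).

(** Replace the coordinate [e] of [g] by its linear interpolation and call
the new path [h].  The bound of [calibration_step], with [mu] the mean slope
of the coordinate before [tau] and then its mean slope after [tau],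
calibrates [h].  Its total increment is [K] minus a positive multiple of the
square of the deviation from affinity at [tau]; since [h] is no shorter than
[K], that deviation vanishes. *)
Lemma straighten_unit g (K : R) e : 0 <= K ->
  (forall t, 0 <= t -> t <= 1 -> X (g t)) ->
  (forall a b, 0 <= a -> a <= b -> b <= 1 -> enorm (g b - g a) <= K * (b - a)) ->
  (K%:E <= dist X (g 0%R) (g 1%R))%E ->
  (forall t, 0 <= t -> t <= 1 -> orthant (e |: axes (g t))%SET `<=` X) ->
  forall t, 0 <= t -> t <= 1 -> g t 0 e = (1 - t) * g 0 0 e + t * g 1 0 e.
Proof.
move=> K0 gX gK Kd eX tau tau0 tau1.
have [K_eq0|Kn0] := eqVneq K 0.
  have cst t : 0 <= t -> t <= 1 -> g t 0 e = g 0 0 e.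
    move=> t0 t1; apply/eqP; rewrite -subr_eq0 -normr_eq0 eq_le normr_ge0 andbT.
    have := gK 0 t (lexx _) t0 t1; rewrite K_eq0 mul0r; apply: le_trans.
    by apply: le_trans (coord_le_enorm _ e); rewrite !mxE.
  by rewrite cst// (cst 1)//; ring.
have {Kn0}K0 : 0 < K by rewrite lt_neqAle eq_sym Kn0.
have [->|tn0] := eqVneq tau 0; first by ring.
have [->|tn1] := eqVneq tau 1; first by ring.
have {tn0}tau0 : 0 < tau by rewrite lt_neqAle eq_sym tn0.
have {tn1}tau1 : tau < 1 by rewrite lt_neqAle tn1.
pose L := g 1 0 e - g 0 0 e.
pose h t : 'rV[R]_M :=
  \row_f (if f == e then (1 - t) * g 0 0 e + t * g 1 0 e else g t 0 f).
have h_sq a b : enorm (h b - h a) ^+ 2 =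
    enorm (g b - g a) ^+ 2 - (g b 0 e - g a 0 e) ^+ 2 + L ^+ 2 * (b - a) ^+ 2.
  rewrite !enorm_sq (bigD1 e)//= [in RHS](bigD1 e)//= !mxE eqxx.
  rewrite (eq_bigr (fun f => (g b - g a) 0 f ^+ 2)); last first.
    by move=> f fe; rewrite !mxE (negbTE fe).
  by rewrite /L; ring.
have gsq a b : 0 <= a -> a <= b -> b <= 1 ->
    enorm (g b - g a) ^+ 2 <= K ^+ 2 * (b - a) ^+ 2.
  move=> a0 ab b1; rewrite -exprMn ler_pXn2r// ?nnegrE ?enorm_ge0 ?gK//.
  by rewrite mulr_ge0 ?subr_ge0// ltW.
have hX' t : 0 <= t -> t <= 1 -> X (h t).
  move=> t0 t1; apply: (stratum_point hX (eX t t0 t1)) => [f|].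
    rewrite mxE; case: ifP => _; last exact: (coord_ge0 hX _ (gX _ t0 t1)).
    by rewrite addr_ge0// mulr_ge0 ?subr_ge0// (coord_ge0 hX)//; exact: gX.
  by apply/fintype.subsetP => f; rewrite !inE mxE; case: ifP.
have hLip a b : 0 <= a -> a <= b -> b <= 1 -> enorm (h b - h a) <= (K + `|L|) * (b - a).
  move=> a0 ab b1; have d0 : 0 <= b - a by rewrite subr_ge0.
  have KL0 : 0 <= K + `|L| by rewrite addr_ge0// ltW.
  rewrite -(@ler_pXn2r _ 2)// ?nnegrE ?enorm_ge0 ?mulr_ge0//.
  rewrite h_sq exprMn [(K + _) ^+ 2]sqrrD real_normK ?num_real//.
  have := gsq a b a0 ab b1; have : 0 <= K * `|L| *+ 2 * (b - a) ^+ 2.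
    by rewrite mulr_ge0 ?sqr_ge0// mulrn_wge0// mulr_ge0// ltW.
  by have := sqr_ge0 (g b 0 e - g a 0 e); rewrite !mulrDl; lra.
pose F mu t := K * t + (L ^+ 2 * t - 2 * mu * g t 0 e + mu ^+ 2 * t) / (2 * K).
have hF mu a b : 0 <= a -> a <= b -> b <= 1 -> enorm (h b - h a) <= F mu b - F mu a.
  move=> a0 ab b1.
  have -> : F mu b - F mu a = K * (b - a) +
      (L ^+ 2 * (b - a) - 2 * mu * (g b 0 e - g a 0 e) + mu ^+ 2 * (b - a)) / (2 * K).
    by rewrite /F; field; rewrite gt_eqF.
  by apply: (calibration_step mu K0 _ (h_sq a b)); rewrite ?subr_ge0// gsq.
pose mu1 := (g tau 0 e - g 0 0 e) / tau.
pose mu2 := (g 1 0 e - g tau 0 e) / (1 - tau).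
(* The two calibrations are glued at [tau]; a chord across [tau] is split there. *)
pose Phi t := F mu1 (Num.min t tau) + F mu2 (Num.max t tau).
have hPhi a b : 0 <= a -> a <= b -> b <= 1 -> enorm (h b - h a) <= Phi b - Phi a.
  move=> a0 ab b1; rewrite /Phi.
  have [bt|tb] := leP b tau; have [at_|ta] := leP a tau.
  - by have := hF mu1 a b a0 ab b1; lra.
  - by have := lt_le_trans ta (le_trans ab bt); rewrite ltxx.
  - rewrite (_ : h b - h a = (h b - h tau) + (h tau - h a)); last by rewrite addrA subrK.
    apply: le_trans (enormD _ _) _.
    have := hF mu1 a tau a0 at_ (ltW tau1); have := hF mu2 tau b (ltW tau0) (ltW tb) b1.
    lra.
  - by have := hF mu2 a b a0 ab b1; lra.
have h0 : h 0 = g 0.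
  by apply/rowP => f; rewrite mxE; case: eqP => // ->; ring.
have h1 : h 1 = g 1.
  by apply/rowP => f; rewrite mxE; case: eqP => // ->; ring.
have := dist_le hX' hLip hPhi; rewrite h0 h1 => /(le_trans Kd).
rewrite lee_fin /Phi (min_r (ltW tau1)) (max_l (ltW tau1)) (min_l (ltW tau0)).
rewrite (max_r (ltW tau0)) /F /mu1 /mu2.
set x := g 0 0 e; set y := g 1 0 e; set z := g tau 0 e.
set rhs := (X in K <= X).
have -> : rhs =
    K - ((1 - tau) * (z - x) - tau * (y - z)) ^+ 2 / (2 * K * tau * (1 - tau)).
  rewrite /rhs /L -/x -/y; field.
  by rewrite !gt_eqF//= subr_gt0.
rewrite -subr_ge0 addrC addKr oppr_ge0 pmulr_lle0; last first.
  by rewrite invr_gt0 !mulr_gt0// subr_gt0.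
move=> le0; have : ((1 - tau) * (z - x) - tau * (y - z)) ^+ 2 == 0.
  by rewrite eq_le le0 sqr_ge0.
by rewrite sqrf_eq0 subr_eq0 => /eqP; lra.
Qed.

End Straightening.

(** * Affine functions of time *)

Section Affine.
Variable R : realType.
Implicit Types (f : R -> R) (p q t u : R).

(** Cleared of denominators, so that no assumption p < q is built in. *)
Definition affine_on f p q : Prop :=
  forall t, p <= t -> t <= q -> (q - p) * f t = (q - t) * f p + (t - p) * f q.

Lemma affine_on_pos f p q t u : affine_on f p q -> 0 <= f p -> 0 <= f q ->
  p <= t -> t <= q -> 0 < f t -> p < u -> u < q -> 0 < f u.
Proof.
move=> faff fp fq pt tq ft pu uq; have pq := lt_trans pu uq.
rewrite -(@pmulr_rgt0 _ (q - p)) ?subr_gt0// (faff u) ?ltW//.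
have : 0 < (q - p) * f t by rewrite mulr_gt0 ?subr_gt0.
rewrite (faff t pt tq); have : 0 <= q - t by rewrite subr_ge0.
have : 0 <= t - p by rewrite subr_ge0.
move: fp; rewrite le_eqVlt => /predU1P[<-|fp _ _ _].
  move: fq; rewrite le_eqVlt => /predU1P[<-|fq _ _ _]; first by rewrite !mulr0 addr0 ltxx.
  by rewrite mulr0 add0r mulr_gt0 ?subr_gt0.
by rewrite ltr_pwDl ?mulr_gt0 ?mulr_ge0 ?subr_gt0 ?subr_ge0// ltW.
Qed.

End Affine.

(** * Geodesics *)

Section Geodesic.
Variables (R : realType) (M m : nat) (X : set 'rV[R]_M) (g : R -> 'rV[R]_M) (D : R).
Hypothesis hX : orthant_space m X.
Hypothesis D0 : 0 <= D.
Hypothesis gX : forall t : R, 0 <= t -> t <= 1 -> X (g t).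
Hypothesis gD : forall s t : R, 0 <= s -> s <= t -> t <= 1 ->
  dist X (g s) (g t) = ((t - s) * D)%:E.
Implicit Types (p q s t u : R) (e : 'I_M).

Lemma geodesic_lipschitz s t : 0 <= s -> s <= t -> t <= 1 ->
  enorm (g t - g s) <= D * (t - s).
Proof.
by move=> s0 st t1; rewrite -lee_fin mulrC -gD//; exact: enorm_le_dist.
Qed.

Lemma convex_comb_bounds p q u : 0 <= p -> p <= q -> q <= 1 -> 0 <= u -> u <= 1 ->
  [/\ 0 <= p + u * (q - p), p <= p + u * (q - p), p + u * (q - p) <= q
    & p + u * (q - p) <= 1].
Proof. by move=> p0 pq q1 u0 u1; split; nra. Qed.

(** The stretch of the geodesic is rescaled to the unit interval. *)
Lemma straighten e p q : 0 <= p -> p < q -> q <= 1 ->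
  (forall t, p <= t -> t <= q -> orthant (e |: axes (g t))%SET `<=` X) ->
  affine_on (fun t => g t 0 e) p q.
Proof.
move=> p0 pq q1 eX t pt tq.
have qp0 : 0 < q - p by rewrite subr_gt0.
have cc u (u0 : 0 <= u) (u1 : u <= 1) := convex_comb_bounds p0 (ltW pq) q1 u0 u1.
have := @straighten_unit _ _ _ _ hX (fun u => g (p + u * (q - p))) (D * (q - p)) e.
move=> /(_ _ _ _ _ _ ((t - p) / (q - p))).
rewrite divfK ?gt_eqF// [p + (t - p)]addrC subrK mul0r mul1r addr0 [p + (q - p)]addrC subrK.
move=> -> //.
- by field; rewrite gt_eqF.
- by rewrite mulr_ge0// ltW.
- by move=> u u0 u1; have [? _ _ ?] := cc u u0 u1; exact: gX.
- move=> a b a0 ab b1.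
  have [? _ _ _] := cc a a0 (le_trans ab b1); have [_ _ _ ?] := cc b (le_trans a0 ab) b1.
  apply: le_trans (geodesic_lipschitz _ _ _) _ => //.
    by rewrite lerD2l ler_wpM2r// ltW.
  by rewrite le_eqVlt; apply/orP; left; apply/eqP; ring.
- by rewrite gD ?(ltW pq)// mulrC.
- by move=> u u0 u1; have [_ ? ? _] := cc u u0 u1; exact: eX.
- by rewrite divr_ge0 ?subr_ge0// ltW.
- by rewrite ler_pdivrMr// mul1r lerD2r.
Qed.

(** The straight segment is itself a path in [X], so the distance between
its end points is their Euclidean distance. *)
Lemma affine_speed p q : 0 <= p -> p < q -> q <= 1 ->
  (forall e, affine_on (fun t => g t 0 e) p q) -> enorm (g q - g p) = D * (q - p).
Proof.
move=> p0 pq q1 gaff; apply/eqP; rewrite eq_le geodesic_lipschitz ?(ltW pq)//=.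
have qp0 : 0 < q - p by rewrite subr_gt0.
have cc u (u0 : 0 <= u) (u1 : u <= 1) := convex_comb_bounds p0 (ltW pq) q1 u0 u1.
pose h u := g (p + u * (q - p)).
have hE u : 0 <= u -> u <= 1 -> h u = g p + u *: (g q - g p).
  move=> u0 u1; apply/rowP => e; rewrite /h !mxE.
  have [_ ? ? _] := cc u u0 u1.
  have := gaff e (p + u * (q - p)); rewrite /affine_on => /(_ _ _)/= ge.
  by apply: (mulfI (x := q - p)); rewrite ?gt_eqF// ge//; ring.
have hS a b : 0 <= a -> a <= b -> b <= 1 ->
    enorm (h b - h a) <= enorm (g q - g p) * b - enorm (g q - g p) * a.
  move=> a0 ab b1; rewrite !hE ?(le_trans ab)// ?(le_trans a0)//.
  rewrite opprD addrACA subrr add0r -scalerBl enormZ ger0_norm ?subr_ge0//.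
  by rewrite le_eqVlt; apply/orP; left; apply/eqP; ring.
have hX' u : 0 <= u -> u <= 1 -> X (h u).
  by move=> u0 u1; have [? _ _ ?] := cc u u0 u1; exact: gX.
have hL a b : 0 <= a -> a <= b -> b <= 1 -> enorm (h b - h a) <= enorm (g q - g p) * (b - a).
  by rewrite mulrBr; exact: hS.
have := dist_le hX' hL (Phi := fun u => enorm (g q - g p) * u) hS.
rewrite /h mul0r mul1r addr0 [p + (q - p)]addrC subrK gD ?(ltW pq)//.
by rewrite lee_fin mulr0 mulr1 subr0 mulrC.
Qed.

End Geodesic.

(** * Axes along the carrier of a geodesic *)

Section Carrier.
Variables (R : realType) (M m : nat) (X : set 'rV[R]_M) (g : R -> 'rV[R]_M) (D : R).
Hypothesis hX : orthant_space m X.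
Hypothesis D0 : 0 <= D.
Hypothesis gX : forall t : R, 0 <= t -> t <= 1 -> X (g t).
Hypothesis gD : forall s t : R, 0 <= s -> s <= t -> t <= 1 ->
  dist X (g s) (g t) = ((t - s) * D)%:E.
Variables (k : nat) (O : nat -> {set 'I_M}) (t : nat -> R).
Hypothesis t0 : t 0%N = 0.
Hypothesis t1 : t k.+1 = 1.
Hypothesis tS : forall i, (i <= k)%N -> t i < t i.+1.
Hypothesis gO : forall i, (i <= k)%N ->
  forall s, t i < s -> s < t i.+1 -> orthant (O i) (g s).
Implicit Types (e f : 'I_M) (i j a b l : nat).

Lemma time_lt i j : (i < j)%N -> (j <= k.+1)%N -> t i < t j.
Proof.
elim: j => // j IH; rewrite ltnS leq_eqVlt => /predU1P[->|ij] jk; first exact: tS.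
by apply: lt_trans (IH ij (ltnW jk)) (tS _).
Qed.

Lemma time_le i j : (i <= j)%N -> (j <= k.+1)%N -> t i <= t j.
Proof. by rewrite leq_eqVlt => /predU1P[->//|ij jk]; exact/ltW/time_lt. Qed.

Lemma time_ge0 i : (i <= k.+1)%N -> 0 <= t i.
Proof. by move=> ik; rewrite -t0 time_le. Qed.

Lemma time_le1 i : (i <= k.+1)%N -> t i <= 1.
Proof. by move=> ik; rewrite -t1 time_le. Qed.

Definition mid i : R := (t i + t i.+1) / 2.

Lemma mid_bounds i : (i <= k)%N -> t i < mid i /\ mid i < t i.+1.
Proof. by move=> ik; have := tS ik; rewrite /mid; split; lra. Qed.

Lemma gX_time i s : (i <= k)%N -> t i <= s -> s <= t i.+1 -> X (g s).
Proof.
move=> ik si sj; apply: gX; first exact: le_trans (time_ge0 (leqW ik)) si.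
exact: le_trans sj (time_le1 _).
Qed.

Lemma carrier_stratum i : (i <= k)%N -> orthant (O i) `<=` X.
Proof.
move=> ik; have [m1 m2] := mid_bounds ik.
by apply: (meets_stratum hX (gO ik m1 m2)); apply: (gX_time ik); exact: ltW.
Qed.

Lemma coord_pos i e s : (i <= k)%N -> e \in O i -> t i < s -> s < t i.+1 -> 0 < g s 0 e.
Proof. by move=> ik ei is1 si1; have [/(_ _ ei)] := gO ik is1 si1. Qed.

Lemma mem_carrier i e : (i <= k)%N -> 0 < g (mid i) 0 e -> e \in O i.
Proof.
move=> ik; have [m1 m2] := mid_bounds ik; have [_ z] := gO ik m1 m2.
by apply: contraLR => /z ->; rewrite ltxx.
Qed.

(** On the closed interval the claim follows from the open one by the
Lipschitz bound: a nonzero value at an end point would persist for a while. *)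
Lemma coord_zero i e s : (i <= k)%N -> e \notin O i -> t i <= s -> s <= t i.+1 -> g s 0 e = 0.
Proof.
move=> ik ei is1 si1.
have open u : t i < u -> u < t i.+1 -> g u 0 e = 0.
  by move=> iu ui; have [_ ->] := gO ik iu ui.
have tk0 : 0 <= t i by rewrite time_ge0// leqW.
have tk1 : t i.+1 <= 1 by rewrite time_le1.
have [m1 m2] := mid_bounds ik.
have lip u v : t i <= u -> u <= v -> v <= t i.+1 -> `|g v 0 e - g u 0 e| <= D * (v - u).
  move=> iu uv vi; have u0 := le_trans tk0 iu; have v1 := le_trans vi tk1.
  apply: le_trans (geodesic_lipschitz gD u0 uv v1).
  by apply: le_trans (coord_le_enorm _ e); rewrite !mxE.
apply/eqP; rewrite -normr_eq0 eq_le normr_ge0 andbT leNgt; apply/negP => gs0.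
(* Moving [s] by [del] into the open interval changes the coordinate by less
   than its value at [s]. *)
pose del := Num.min ((mid i - t i) / 2) (`|g s 0 e| / (2 * (D + 1))).
have del0 : 0 < del by rewrite lt_min !divr_gt0 ?subr_gt0 ?mulr_gt0 ?ltr_wpDl.
have delm : del <= (mid i - t i) / 2 by rewrite ge_min lexx.
have delD : D * del < `|g s 0 e|.
  have : del <= `|g s 0 e| / (2 * (D + 1)) by rewrite ge_min lexx orbT.
  rewrite ler_pdivlMr; last by rewrite mulr_gt0// ltr_wpDl.
  by have := mulr_ge0 D0 (ltW del0); lra.
have : mid i - t i = t i.+1 - mid i by rewrite /mid; field.
move=> mm; have [sm|ms] := leP s (mid i).
  have := lip s (s + del) is1; rewrite (open (s + del)); [|lra|lra].
  by rewrite sub0r normrN [s + del - s]addrC addKr; lra.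
have := lip (s - del) s; rewrite (open (s - del)); [|lra|lra].
by rewrite subr0 subKr; lra.
Qed.

Lemma axes_sub_carrier i s : (i <= k)%N -> t i <= s -> s <= t i.+1 -> axes (g s) \subset O i.
Proof.
move=> ik si si1; apply/fintype.subsetP => e; rewrite inE; apply: contraTT => ei.
by rewrite (coord_zero ik ei si si1) ltxx.
Qed.

Lemma time_cover a b s : (a <= b)%N -> t a <= s -> s <= t b.+1 ->
  exists i, [/\ (a <= i)%N, (i <= b)%N, t i <= s & s <= t i.+1].
Proof.
elim: b => [|b IH].
  by rewrite leqn0 => /eqP -> ? ?; exists 0%N.
move=> ab as_ sb; have [bs|sb'] := leP (t b.+1) s; first by exists b.+1.
move: ab; rewrite leq_eqVlt => /predU1P[ab|ab].
  by have := le_lt_trans as_ sb'; rewrite ab ltxx.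
by have [i [? ? ? ?]] := IH ab as_ (ltW sb'); exists i; split => //; exact: leqW.
Qed.

(** Only the strata met matter: at each time the axes of the point lie in
one of the sets [O i], also at the instants of transition. *)
Lemma straighten_range e a b : (a <= b)%N -> (b <= k)%N ->
  (forall i, (a <= i)%N -> (i <= b)%N -> orthant (e |: O i)%SET `<=` X) ->
  affine_on (fun s => g s 0 e) (t a) (t b.+1).
Proof.
move=> ab bk eX; apply: (straighten hX D0 gX gD).
- by apply: time_ge0; lia.
- by apply: time_lt; lia.
- exact: time_le1.
move=> s as_ sb; have [i [ai ib si si1]] := time_cover ab as_ sb.
apply: (stratum_sub hX _ (eX i ai ib)); apply: finset.setUS.
by apply: axes_sub_carrier => //; lia.
Qed.

Lemma affine_while_present e a b : (a <= b)%N -> (b <= k)%N ->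
  (forall i, (a <= i)%N -> (i <= b)%N -> e \in O i) ->
  affine_on (fun s => g s 0 e) (t a) (t b.+1).
Proof.
move=> ab bk eO; apply: straighten_range => // i ai ib.
by rewrite (finset.setUidPr _) ?finset.sub1set ?eO//; apply: carrier_stratum; lia.
Qed.

(** A nonnegative affine function that is positive somewhere is positive at
every interior time. *)
Lemma affine_pos_middle e a b : (a <= b)%N -> (b <= k)%N ->
  affine_on (fun s => g s 0 e) (t a) (t b.+1) ->
  forall i j, (a <= i)%N -> (i <= b)%N -> (a <= j)%N -> (j <= b)%N ->
  e \in O i -> e \in O j.
Proof.
move=> ab bk gaff i j ai ib aj jb ei.
have ik := leq_trans ib bk; have jk := leq_trans jb bk.
have ti := time_le ai (leqW ik); have tj := time_le aj (leqW jk).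
have ti' : t i.+1 <= t b.+1 by exact: time_le.
have tj' : t j.+1 <= t b.+1 by exact: time_le.
have [m1 m2] := mid_bounds ik; have [n1 n2] := mid_bounds jk.
have gb0 : 0 <= g (t b.+1) 0 e.
  by apply: (coord_ge0 hX); apply: gX; [exact: time_ge0|exact: time_le1].
have ga0 : 0 <= g (t a) 0 e.
  have ak : (a <= k.+1)%N := leq_trans ab (leqW bk).
  by apply: (coord_ge0 hX); apply: gX; [exact: time_ge0|exact: time_le1].
apply: mem_carrier => //.
apply: (affine_on_pos gaff ga0 gb0 _ _ (coord_pos ik ei m1 m2)).
- exact: le_trans ti (ltW m1).
- exact: le_trans (ltW m2) ti'.
- exact: le_lt_trans tj n1.
- exact: lt_le_trans n2 tj'.
Qed.

(** While present without interruption, the coordinate is affine; it vanishes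
at the times of entry and exit, hence between them.  The induction on
[b - a] reduces to an uninterrupted presence. *)
Lemma no_temporary_axis e a l b : (a < l)%N -> (l < b)%N -> (b <= k)%N ->
  e \notin O a -> e \notin O b -> e \notin O l.
Proof.
have [n] := ubnP (b - a); elim: n a l b => // n IH a l b ban al lb bk ea eb.
have [/forallP all_in|] := boolP [forall i : 'I_b, (a < i)%N ==> (e \in O i)]; last first.
  rewrite negb_forall => /existsP[i]; rewrite negb_imply => /andP[ai ei].
  have ib := ltn_ord i.
  have [il|li|<-//] := ltngtP i l.
    by apply: (IH i l b) => //; lia.
  by apply: (IH a l i) => //; lia.
exfalso; case: b => [|b] in ban lb bk eb all_in *; first by [].
have eO i : (a.+1 <= i)%N -> (i <= b)%N -> e \in O i.
  by move=> ai ib; have := all_in (Ordinal (ib : (i < b.+1)%N)); rewrite /= ai.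
have ab : (a.+1 <= b)%N by lia.
have bk' : (b <= k)%N by lia.
have gaff := affine_while_present ab bk' eO.
have lk : (l <= k)%N by lia.
have tal : t a.+1 <= t l by apply: time_le; lia.
have tlb : t l.+1 <= t b.+1 by apply: time_le; lia.
have ga : g (t a.+1) 0 e = 0.
  by apply: (coord_zero (i := a)) => //; [lia|apply: time_le; lia].
have gb : g (t b.+1) 0 e = 0.
  by apply: (coord_zero (i := b.+1)) => //; apply: time_le; lia.
have [m1 m2] := mid_bounds lk; have := coord_pos lk (eO l al lb) m1 m2.
have /= := gaff (mid l); rewrite ga gb !mulr0 addr0 => /(_ _ _)/eqP.
rewrite mulf_eq0 subr_eq0 gt_eqF//=; last by lra.
by move=> /(_ _ _)/eqP ->; rewrite ?ltxx//; lra.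
Qed.

(** By [no_temporary_axis], an axis present between [a] and [b] belongs to
[O a] or to [O b], as [e] does, so it is compatible with [e].  Hence [e] can be
adjoined to all intermediate strata, its coordinate is affine, and it never
vanishes in between. *)
Lemma no_returning_axis e a l b : (a < l)%N -> (l < b)%N -> (b <= k)%N ->
  e \in O a -> e \in O b -> e \in O l.
Proof.
move=> al lb bk ea eb; have ab : (a <= b)%N by lia.
suff gaff : affine_on (fun s => g s 0 e) (t a) (t b.+1).
  by apply: (affine_pos_middle ab bk gaff (i := a)) => //; lia.
apply: straighten_range => // i ai ib; have ik : (i <= k)%N by lia.
apply: (stratum_setU1 hX (carrier_stratum ik)) => f fi.
have [fa|fa] := boolP (f \in O a).
  apply: (stratum_sub hX _ (carrier_stratum (i := a) _)); last by lia.
  by rewrite finset.subUset !finset.sub1set ea.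
have [fb|fb] := boolP (f \in O b).
  apply: (stratum_sub hX _ (carrier_stratum (i := b) _)) => //.
  by rewrite finset.subUset !finset.sub1set eb.
have ai' : (a < i)%N by rewrite ltn_neqAle ai andbT; apply: contraNneq fa => ->.
have ib' : (i < b)%N by rewrite ltn_neqAle ib andbT; apply: contraNneq fb => <-.
by have := no_temporary_axis ai' ib' bk fa fb; rewrite fi.
Qed.

Lemma present_of_ends e i : e \in O 0 -> e \in O k -> (i <= k)%N -> e \in O i.
Proof.
move=> e0 ek ik; have [->//|i0] := eqVneq i 0%N; have [->//|ik'] := eqVneq i k.
by apply: (no_returning_axis (a := 0) (b := k)) => //; lia.
Qed.

Lemma absent_of_ends e i : e \notin O 0 -> e \notin O k -> (i <= k)%N -> e \notin O i.
Proof.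
move=> e0 ek ik; have [->//|i0] := eqVneq i 0%N; have [->//|ik'] := eqVneq i k.
by apply: (no_temporary_axis (a := 0) (b := k)) => //; lia.
Qed.

(** By [no_temporary_axis], the axis stays absent once it has vanished.  Its
coordinate, affine and positive until then, cannot start from zero. *)
Lemma dying_axis e : e \in O 0 -> e \notin O k ->
  exists j, [/\ (0 < j <= k)%N, forall i, (i <= k)%N -> (e \in O i) = (i < j)%N,
    affine_on (fun s => g s 0 e) 0 (t j), g (t j) 0 e = 0 & 0 < g 0 0 e].
Proof.
move=> e0 ek; have ex : exists i, e \notin O i by exists k.
case: (ex_minnP ex) => j ej jmin; exists j.
have j0 : (0 < j)%N by rewrite lt0n; apply: contraNneq ej => ->.
have jk : (j <= k)%N by exact: jmin.
have before i : (i < j)%N -> e \in O i.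
  by move=> ij; apply/negPn/negP => /jmin; rewrite leqNgt ij.
have eO i : (i <= k)%N -> (e \in O i) = (i < j)%N.
  move=> ik; have [ij|ji] := ltnP i j; first exact: before.
  apply/negbTE; have [<-//|ij] := eqVneq j i; have [->//|ik'] := eqVneq i k.
  by apply: (no_temporary_axis (a := j) (b := k)) => //; lia.
have gj : g (t j) 0 e = 0.
  by apply: (coord_zero (i := j)) => //; apply: time_le; lia.
have gaff : affine_on (fun s => g s 0 e) 0 (t j).
  rewrite -t0 -(prednK j0); apply: affine_while_present => //; first by lia.
  by move=> i _ ij; apply: before; lia.
split=> //; rewrite ?j0// lt_neqAle (coord_ge0 hX) ?andbT; last by exact: gX.
apply/eqP => g0; have [m1 m2] := mid_bounds (leq0n k).
have := coord_pos (leq0n k) e0 m1 m2.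
have t1j : t 1 <= t j by apply: time_le; lia.
rewrite t0 in m1.
have /= := gaff (mid 0); rewrite -g0 gj !mulr0 addr0 subr0 => /(_ _ _)/eqP.
rewrite mulf_eq0 gt_eqF//=; last by lra.
by move=> /(_ _ _)/eqP ->; rewrite ?ltxx//; lra.
Qed.

(** By [no_temporary_axis], the axis stays present once it has appeared.  Its
coordinate, affine and positive from then on, cannot end at zero. *)
Lemma born_axis e : e \notin O 0 -> e \in O k ->
  exists j, [/\ (0 < j <= k)%N, forall i, (i <= k)%N -> (e \in O i) = (j <= i)%N,
    affine_on (fun s => g s 0 e) (t j) 1, g (t j) 0 e = 0 & 0 < g 1 0 e].
Proof.
move=> e0 ek; have ex : exists i, e \in O i by exists k.
case: (ex_minnP ex) => j ej jmin; exists j.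
have j0 : (0 < j)%N by rewrite lt0n; apply: contraTneq ej => ->.
have jk : (j <= k)%N by exact: jmin.
have after i : (j <= i)%N -> (i <= k)%N -> e \in O i.
  move=> ji ik; have [<-//|ij] := eqVneq j i; apply: contraTT ej => ei.
  by apply: (no_temporary_axis (a := 0) (b := i)) => //; lia.
have eO i : (i <= k)%N -> (e \in O i) = (j <= i)%N.
  move=> ik; have [ij|ji] := leqP j i; first exact: after.
  by apply: contraTF ji => /jmin; rewrite leqNgt.
have gj : g (t j) 0 e = 0.
  apply: (coord_zero (i := j.-1)); [lia| |apply: time_le; lia|rewrite prednK//].
  by rewrite eO; lia.
have gaff : affine_on (fun s => g s 0 e) (t j) 1.
  by rewrite -t1; apply: affine_while_present.
split=> //; rewrite ?j0// lt_neqAle (coord_ge0 hX) ?andbT; last by exact: gX.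
apply/eqP => g1; have [m1 m2] := mid_bounds (leqnn k).
have := coord_pos (leqnn k) ek m1 m2.
have tjk : t j <= t k by apply: time_le; lia.
rewrite t1 in m2.
have /= := gaff (mid k); rewrite -g1 gj !mulr0 addr0 => /(_ _ _)/eqP.
rewrite mulf_eq0 gt_eqF//=; last by lra.
by move=> /(_ _ _)/eqP ->; rewrite ?ltxx//; lra.
Qed.

Lemma start_zero e : e \notin O 0 -> g 0 0 e = 0.
Proof. by move=> e0; apply: (coord_zero (i := 0)) => //; rewrite ?t0// -t0 time_le. Qed.

Lemma end_zero e : e \notin O k -> g 1 0 e = 0.
Proof. by move=> ek; apply: (coord_zero (i := k)) => //; rewrite ?t1// -t1 time_le. Qed.

Lemma persistent_affine e : (e \in O 0) = (e \in O k) -> affine_on (fun s => g s 0 e) 0 1.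
Proof.
have [e0 ek|e0 ek] := boolP (e \in O 0).
  rewrite -t0 -t1; apply: affine_while_present => // i _ ik.
  exact: present_of_ends.
move=> s s0 s1; rewrite start_zero// end_zero -?ek// !mulr0 addr0.
rewrite -t0 in s0; rewrite -t1 in s1.
have [i [_ ik si si1]] := time_cover (leq0n k) s0 s1.
rewrite (coord_zero ik _ si si1) ?mulr0//; apply: absent_of_ends => //.
by rewrite -ek.
Qed.

(** An axis of [x] that is absent at the start but compatible with the axes
of [xs] would be compatible with every axis met on the way: such an axis
either survives until the end, together with [e], or is an axis of [xs], being
one that dies.  By straightening, [e] would then be present from the start.
The case of an axis of [xs] compatible with those of [x] is symmetric.
Conversely, the coordinate of an axis present throughout is affine and positive
inside, so it is positive at one end at least, and the axes of the other end
lie in a stratum that contains the axis. *)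
Lemma mem_common_axes e : (e \in common_axes X (g 0) (g 1)) = (e \in O 0) && (e \in O k).
Proof.
have [e0|e0] := boolP (e \in O 0); have [ek|ek] := boolP (e \in O k) => /=.
- have gaff : affine_on (fun s => g s 0 e) 0 1 by apply: persistent_affine; rewrite e0 ek.
  have [m1 m2] := mid_bounds (leq0n k).
  have pos := coord_pos (leq0n k) e0 m1 m2.
  have t11 : t 1 <= 1 by rewrite time_le1.
  rewrite t0 in m1.
  rewrite !inE; have [g0|g0] := ltP 0 (g 0 0 e).
    rewrite /=; have [g1|g1] := ltP 0 (g 1 0 e); first by [].
    rewrite /= orbF; apply/asboolP; rewrite /compatible.
    apply: (stratum_sub hX _ (carrier_stratum (leqnn k))).
    rewrite finset.subUset finset.sub1set ek/=; apply: axes_sub_carrier => //.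
      exact: time_le1.
    by rewrite t1.
  have [g1|g1] := ltP 0 (g 1 0 e).
    rewrite /=; apply/asboolP; rewrite /compatible.
    apply: (stratum_sub hX _ (carrier_stratum (leq0n k))).
    rewrite finset.subUset finset.sub1set e0/=; apply: axes_sub_carrier => //.
      by rewrite t0.
    exact: time_ge0.
  exfalso; have := gaff (mid 0); have /= := pos.
  nra.
- have /= g1 := end_zero ek; rewrite !inE g1 ltxx andbF/= orbF.
  apply/negbTE/negP => /andP[g0 /asboolP eX].
  suff : e \in O k by rewrite (negbTE ek).
  have gaff : affine_on (fun s => g s 0 e) (t 0) (t k.+1).
    apply: straighten_range => // i _ ik.
    apply: (stratum_setU1 hX (carrier_stratum ik)) => f fi.
    have [f0|f0] := boolP (f \in O 0).
      apply: (stratum_sub hX _ (carrier_stratum (leq0n k))).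
      by rewrite finset.subUset !finset.sub1set e0.
    have fk : f \in O k by apply: contraTT fi => fk; exact: absent_of_ends.
    have [j [_ _ _ _ f1]] := born_axis f0 fk.
    apply: (stratum_sub hX _ eX); apply: finset.setUS.
    by rewrite finset.sub1set inE.
  by apply: (affine_pos_middle _ _ gaff (i := 0)).
- have /= g0 := start_zero e0; rewrite !inE g0 ltxx /=.
  apply/negbTE/negP => /andP[g1 /asboolP eX].
  suff : e \in O 0 by rewrite (negbTE e0).
  have gaff : affine_on (fun s => g s 0 e) (t 0) (t k.+1).
    apply: straighten_range => // i _ ik.
    apply: (stratum_setU1 hX (carrier_stratum ik)) => f fi.
    have [fk|fk] := boolP (f \in O k).
      apply: (stratum_sub hX _ (carrier_stratum (leqnn k))).
      by rewrite finset.subUset !finset.sub1set ek.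
    have f0 : f \in O 0 by apply: contraTT fi => f0; exact: absent_of_ends.
    have [j [_ _ _ _ f1]] := dying_axis f0 fk.
    apply: (stratum_sub hX _ eX); apply: finset.setUS.
    by rewrite finset.sub1set inE.
  by apply: (affine_pos_middle _ _ gaff (i := k)).
- by rewrite !inE start_zero// end_zero// ltxx.
Qed.

(** * Speed, and the balance at a change of stratum *)

Lemma segment_affine e i : (i <= k)%N -> affine_on (fun s => g s 0 e) (t i) (t i.+1).
Proof.
move=> ik; have [ei|ei] := boolP (e \in O i).
  apply: affine_while_present => // j ij ji.
  by rewrite (_ : j = i)//; apply/eqP; rewrite eqn_leq ji.
move=> s is1 si1; rewrite !(coord_zero ik ei) ?lexx ?(ltW (tS ik))//.
by rewrite !mulr0 addr0.
Qed.

Lemma segment_speed i : (i <= k)%N -> enorm (g (t i.+1) - g (t i)) = D * (t i.+1 - t i).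
Proof.
move=> ik; apply: (affine_speed gX gD); [|exact: tS|exact: time_le1|].
  by rewrite time_ge0// leqW.
by move=> e; exact: segment_affine.
Qed.

(** [no_temporary_axis] excludes an earlier absence and [no_returning_axis] a
later return, so the index given by [dying_axis] is [j.+1]. *)
Lemma leaving_axis e j : (j < k)%N -> e \in O j -> e \notin O j.+1 ->
  [/\ affine_on (fun s => g s 0 e) 0 (t j.+1), g (t j.+1) 0 e = 0, 0 < g 0 0 e
    & forall i, (i <= k)%N -> (e \in O i) = (i <= j)%N].
Proof.
move=> jk ej ej1.
have e0 : e \in O 0.
  apply: contraTT ej => e0; have [->//|j0] := eqVneq j 0%N.
  by apply: (no_temporary_axis (a := 0) (b := j.+1)) => //; lia.
have ek : e \notin O k.
  apply: contraNN ej1 => ek; have [->//|jk'] := eqVneq j.+1 k.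
  by apply: (no_returning_axis (a := j) (b := k)) => //; lia.
have [j' [/andP[j'0 j'k] eO gaff gz g0]] := dying_axis e0 ek.
have <- : j' = j.+1.
  by move: ej ej1; rewrite !eO//; [lia|exact: ltnW].
split=> // i ik; rewrite eO//; move: ej ej1; rewrite !eO//; [lia|exact: ltnW].
Qed.

Lemma entering_axis e j : (j < k)%N -> e \notin O j -> e \in O j.+1 ->
  [/\ affine_on (fun s => g s 0 e) (t j.+1) 1 & g (t j.+1) 0 e = 0].
Proof.
move=> jk ej ej1.
have e0 : e \notin O 0.
  apply: contraNN ej => e0; have [->//|j0] := eqVneq j 0%N.
  by apply: (no_returning_axis (a := 0) (b := j.+1)) => //; lia.
have ek : e \in O k.
  apply: contraTT ej1 => ek; have [->//|jk'] := eqVneq j.+1 k.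
  by apply: (no_temporary_axis (a := j) (b := k)) => //; lia.
have [j' [/andP[j'0 j'k] eO gaff gz g0]] := born_axis e0 ek.
have <- // : j' = j.+1.
by move: ej ej1; rewrite !eO//; [lia|exact: ltnW].
Qed.

Lemma enorm_axes_proj (E : {set 'I_M}) (v : 'rV[R]_M) :
  enorm (axes_proj E v) ^+ 2 = \sum_e (if e \in E then v 0 e ^+ 2 else 0).
Proof. by rewrite enorm_sq; apply: eq_bigr => e _; rewrite mxE; case: ifP; rewrite ?expr0n. Qed.

(** The speed is the same before and after the transition, and the velocities
along all axes outside the two exchanged sets agree.  The assertion [cases]
compares squared velocities axis by axis; summing it leaves the equality of
the two partial norms. *)
Lemma balance j : (j < k)%N ->
  enorm (axes_proj (O j :\: O j.+1)%SET (g 0)) * (1 - t j.+1) =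
  enorm (axes_proj (O j.+1 :\: O j)%SET (g 1)) * t j.+1.
Proof.
move=> jk; have jk1 : (j <= k)%N := ltnW jk.
have [p0 q1] : 0 <= t j /\ t j.+2 <= 1 by split; [exact/time_ge0/leqW|exact: time_le1].
have ps := tS jk1; have sq := tS jk.
have sp1 := segment_speed jk1; have sp2 := segment_speed jk.
have s0 : 0 < t j.+1 by exact: le_lt_trans ps.
have s1 : 0 < 1 - t j.+1 by rewrite subr_gt0; exact: lt_le_trans q1.
have sn0 : t j.+1 != 0 by rewrite gt_eqF.
have sn1 : 1 - t j.+1 != 0 by rewrite gt_eqF.
have psn : t j.+1 - t j != 0 by rewrite gt_eqF ?subr_gt0.
have sqn : t j.+2 - t j.+1 != 0 by rewrite gt_eqF ?subr_gt0.
have cases e : (g (t j.+1) - g (t j)) 0 e ^+ 2 / (t j.+1 - t j) ^+ 2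
    + (if e \in (O j.+1 :\: O j)%SET then g 1 0 e ^+ 2 else 0) / (1 - t j.+1) ^+ 2
  = (g (t j.+2) - g (t j.+1)) 0 e ^+ 2 / (t j.+2 - t j.+1) ^+ 2
    + (if e \in (O j :\: O j.+1)%SET then g 0 0 e ^+ 2 else 0) / (t j.+1) ^+ 2.
  rewrite !inE !mxE; have [ej|ej] := boolP (e \in O j);
    have [ej1|ej1] := boolP (e \in O j.+1) => /=.
  - have gaff : affine_on (fun s => g s 0 e) (t j) (t j.+2).
      apply: affine_while_present => // i ji; rewrite leq_eqVlt => /predU1P[->//|ij].
      by rewrite (_ : i = j)//; apply/eqP; rewrite eqn_leq -ltnS ij.
    rewrite !mul0r !addr0 -!expr_div_n; congr (_ ^+ 2).
    apply/eqP; rewrite eqr_div//; apply/eqP.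
    by have /= := gaff _ (ltW ps) (ltW sq); lra.
  - have [gaff gz _ _] := leaving_axis jk ej ej1.
    rewrite gz (coord_zero jk ej1 (ltW sq) (lexx _)) subrr expr0n/= !mul0r !addr0 !add0r.
    have /= := gaff (t j) p0 (ltW ps); rewrite gz mulr0 addr0 subr0 => ge.
    rewrite -!expr_div_n mulNr sqrrN; congr (_ ^+ 2).
    apply/eqP; rewrite eqr_div//.
    by rewrite mulrC ge mulrC.
  - have [gaff gz] := entering_axis jk ej ej1.
    rewrite gz (coord_zero jk1 ej (lexx _) (ltW ps)) subrr expr0n/= !mul0r !addr0 !add0r subr0.
    have /= := gaff (t j.+2) (ltW sq) q1; rewrite gz mulr0 add0r => ge.
    rewrite -!expr_div_n; congr (_ ^+ 2); apply/esym/eqP.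
    rewrite eqr_div//.
    by rewrite mulrC ge mulrC.
  - have z1 := coord_zero jk1 ej (lexx _) (ltW ps).
    have z2 := coord_zero jk1 ej (ltW ps) (lexx _).
    have z3 := coord_zero jk ej1 (ltW sq) (lexx _).
    by rewrite z1 z2 z3 !subrr expr0n/= !mul0r.
have : \sum_(e < M) _ = \sum_(e < M) _ := eq_bigr _ (fun e _ => cases e).
rewrite !big_split/= -!mulr_suml -!enorm_sq -!enorm_axes_proj sp1 sp2.
rewrite !exprMn !mulfK ?sqrf_eq0// => /addrI/eqP.
rewrite eqr_div ?sqrf_eq0// -!exprMn eqrXn2 ?mulr_ge0 ?enorm_ge0 ?ltW//.
by move/eqP.
Qed.

(** * The initial velocity *)

Definition velocity : 'rV[R]_M := (t 1)^-1 *: (g (t 1) - g 0).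

Lemma first_time_gt0 : 0 < t 1.
Proof. by rewrite -t0; exact: tS. Qed.

Lemma initial_segment s : 0 <= s -> s <= t 1 -> g s - g 0 = s *: velocity.
Proof.
move=> s0 st; have p := first_time_gt0; apply/rowP => e; rewrite !mxE.
have /= := @segment_affine e 0%N (leq0n k); rewrite t0 => /(_ s s0 st)/=.
rewrite !subr0 => ge; apply: (mulfI (lt0r_neq0 p)).
by rewrite mulrBr ge; field; rewrite gt_eqF.
Qed.

Lemma cvg_velocity : s^-1 *: (g s - g 0) @[s --> 0^'+] --> velocity.
Proof.
apply: cvg_near_cst; near=> s.
have s0 : 0 < s by [].
rewrite initial_segment ?(ltW s0)//; last first.
  by near: s; apply: nbhs_right_le; exact: first_time_gt0.
by rewrite scalerA mulVf ?scale1r// gt_eqF.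
Unshelve. all: by end_near.
Qed.

Lemma enorm_velocity : enorm velocity = D.
Proof.
have p := first_time_gt0; rewrite /velocity enormZ -t0 segment_speed// t0 subr0.
by rewrite gtr0_norm ?invr_gt0// mulrCA mulVf ?mulr1// gt_eqF.
Qed.

(** The axes of the first stratum that [g 0] lacks can only increase.  Adding
a multiple of [g 0] changes the coordinates along the linear part of the cone
only, so one statement serves for the velocity and for its translate. *)
Lemma velocity_tangent (a : R) : tangent_cone X (g 0) (velocity + a *: g 0).
Proof.
have p := first_time_gt0.
have sub0 : axes (g 0) \subset O 0.
  by apply: axes_sub_carrier; rewrite // ?t0// ltW.
have uO : (axes (g 0) :|: O 0 :\: axes (g 0) = O 0)%SET.
  apply/setP => e; have /implyP := fintype.subsetP sub0 e.
  by rewrite !inE; case: (0 < _) => //= ->.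
exists (O 0 :\: axes (g 0))%SET; rewrite uO; split.
- by rewrite finset.disjoints_subset finset.setDE finset.subsetIr.
- exact: carrier_stratum.
- move=> e; rewrite inE => /andP[ne _]; rewrite !mxE.
  have -> : g 0 0 e = 0.
    apply/eqP; rewrite eq_le (coord_ge0 hX) ?andbT; last exact: gX.
    by move: ne; rewrite inE leNgt.
  rewrite mulr0 addr0 subr0 mulr_ge0 ?invr_ge0 ?(ltW p)// (coord_ge0 hX)//.
  by apply: gX; [exact: ltW|exact: time_le1].
- move=> e ne; rewrite !mxE start_zero// (coord_zero (i := 0) _ ne)//; last first.
    by rewrite t0 ltW.
  by rewrite subrr !mulr0 addr0.
Qed.

Lemma translated_velocity_persistent e : (e \in O 0) = (e \in O k) ->
  (velocity + g 0) 0 e = g 1 0 e.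
Proof.
move=> e0k; have p := first_time_gt0; rewrite !mxE.
have := persistent_affine e0k (ltW p) (time_le1 (ltn0Sn k)); rewrite /= !subr0 mul1r => ->.
by field; rewrite gt_eqF.
Qed.

Lemma translated_velocity_absent e : e \notin O 0 -> (velocity + g 0) 0 e = 0.
Proof.
move=> e0; rewrite !mxE start_zero// (coord_zero (i := 0) _ e0)//.
  by rewrite subrr mulr0 addr0.
by rewrite t0 ltW// first_time_gt0.
Qed.

(** The factor 1 - 1 / t j.+1 is rewritten with [balance]. *)
Lemma translated_velocity_leaving e j : (j < k)%N -> e \in (O j :\: O j.+1)%SET ->
  (velocity + g 0) 0 e =
  - (enorm (axes_proj (O j.+1 :\: O j)%SET (g 1)) /
     enorm (axes_proj (O j :\: O j.+1)%SET (g 0))) * g 0 0 e.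
Proof.
move=> jk eA; move: (eA); rewrite inE => /andP[ej1 ej].
have [gaff gz ge0 _] := leaving_axis jk ej ej1.
have p := first_time_gt0.
have t1j : t 1 <= t j.+1 by apply: time_le => //; exact: leqW.
have tj0 := lt_le_trans p t1j.
have nA : enorm (axes_proj (O j :\: O j.+1)%SET (g 0)) != 0.
  by rewrite gt_eqF// (@enorm_gt0 _ _ _ e)// mxE eA gt_eqF.
have tn0 : t j.+1 != 0 by rewrite gt_eqF.
have /esym/eqP := balance jk; rewrite [eqbRHS]mulrC -eqr_div// => /eqP ->.
have /= := gaff _ (ltW p) t1j; rewrite gz mulr0 addr0 subr0 !mxE => ge.
apply: (mulfI (lt0r_neq0 tj0)).
by rewrite mulrDr mulrCA mulrBr ge; field; rewrite tn0 gt_eqF.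
Qed.

End Carrier.

Theorem theorem1 (R : realType) (M m : nat) (X : set 'rV[R]_M)
    (hX : orthant_space m X) (xs x : 'rV[R]_M) (hxs : X xs) (hx : X x)
    (g : R -> 'rV[R]_M) (hg : is_geodesic X xs x g)
    (k : nat) (A B : k.+1.-tuple {set 'I_M}) (hAB : is_support X xs x g A B) :
  is_translated_log X xs x g
    (jmath A (fun i : 'I_k.+1 =>
       if i == ord0 then axes_proj (tnth B i) x
       else - (enorm (axes_proj (tnth B i) x) / enorm (axes_proj (tnth A i) xs))
              *: axes_proj (tnth A i) xs)).
Proof.
have [D D0 hD] := dist_fin hX hxs hx.
have [[_ g0 g1 gX'] gdist] := hg.
have gX s : 0 <= s -> s <= 1 -> X (g s).
  by move=> s0 s1; apply: gX'; rewrite in_itv/= s0.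
have gD (s t : R) : 0 <= s -> s <= t -> t <= 1 -> dist X (g s) (g t) = ((t - s) * D)%:E.
  move=> s0 st t1; rewrite gdist ?in_itv/= ?s0 ?t1 ?(le_trans st)// ?(le_trans s0)//.
  by rewrite hD distrC ger0_norm ?subr_ge0.
have [OT [[t [t0 t1 tS gO _]] A0 B0 AB]] := hAB.
have gOs i : (i <= k)%N -> forall s, t i < s -> s < t i.+1 ->
    orthant (nth finset.set0 OT i) (g s).
  by move=> ik s si si1; apply: gO => //; rewrite in_itv/= si.
set w := jmath _ _.
pose v := velocity g t.
have tangent (a : R) : tangent_cone X xs (v + a *: xs).
  by rewrite -g0; exact: (velocity_tangent hX D0 gX gD t0 t1 tS gOs).
pose Oi i := nth finset.set0 OT i.
have tA (i : 'I_k) : tnth A (lift ord0 i) = (Oi i :\: Oi i.+1)%SET.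
  by rewrite (tnth_nth finset.set0) lift0; have [] := AB i (ltn_ord i).
have tB (i : 'I_k) : tnth B (lift ord0 i) = (Oi i.+1 :\: Oi i)%SET.
  by rewrite (tnth_nth finset.set0) lift0; have [] := AB i (ltn_ord i).
have common e : (e \in common_axes X xs x) = (e \in Oi 0) && (e \in Oi k).
  by rewrite -g0 -g1; exact: (mem_common_axes hX D0 gX gD t0 t1 tS gOs).
have leaving e (i : 'I_k) : e \in tnth A (lift ord0 i) ->
    forall j, (j <= k)%N -> (e \in Oi j) = (j <= i)%N.
  rewrite tA inE => /andP[ei1 ei].
  by have [] := leaving_axis hX D0 gX gD t0 t1 tS gOs (ltn_ord i) ei ei1.
have wE : w = v + xs.
  apply/rowP => e; rewrite mxE big_mkcond big_ord_recl/= !(tnth_nth finset.set0) A0 B0.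
  rewrite -[in RHS]g0 common; have [e0|e0] := boolP (e \in Oi 0); last first.
    rewrite (translated_velocity_absent D0 gD t0 t1 tS gOs e0) big1 ?addr0// => i _.
    by case: ifP => // /leaving/(_ 0%N (leq0n k)); rewrite leq0n (negbTE e0).
  have [ek|ek] := boolP (e \in Oi k).
    rewrite (translated_velocity_persistent hX D0 gX gD t0 t1 tS gOs); last first.
      by rewrite -/(Oi 0) -/(Oi k) e0 ek.
    rewrite big1 ?addr0; last first.
      move=> i _; case: ifP => // /leaving/(_ k (leqnn k)).
      by rewrite ek leqNgt ltn_ord.
    by rewrite mxE common e0 ek g1.
  have [j [/andP[j0 jk] eO _ _ _]] := dying_axis hX D0 gX gD t0 t1 tS gOs e0 ek.
  have j1k : (j.-1 < k)%N by rewrite prednK.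
  have ej : e \in tnth A (lift ord0 (Ordinal j1k)).
    by rewrite tA inE /= !eO ?prednK// ?ltnn ?leqnn// ltnW.
  rewrite add0r (bigD1 (Ordinal j1k))//= ej big1 ?addr0; last first.
    move=> i ij; case: ifP => // ei; case/eqP: ij; apply/val_inj/anti_leq => /=.
    have ik := ltnW (ltn_ord i); have jk' := ltnW j1k.
    have := leaving e _ ej i ik; rewrite (leaving e i ei) ?leqnn// => /= <-.
    by have := leaving e _ ei j.-1 jk'; rewrite (leaving e _ ej) ?leqnn// => /= <-.
  rewrite tB tA (translated_velocity_leaving hX D0 gX gD t0 t1 tS gOs j1k).
    by rewrite g0 g1 !mxE -tA ej.
  by move: ej; rewrite tA.
exists v; split=> //; last by rewrite wE -[in X in v + X](scale1r xs).
split.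
- exact: (cvg_velocity hX D0 gX gD t0 t1 tS gOs).
- by rewrite hD (enorm_velocity hX D0 gX gD t0 t1 tS gOs).
- by have := tangent 0; rewrite scale0r addr0.
Qed.
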